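(* Let $\underline{Q}$ be an ergodic lower transition rate operator on $\mathcal{L}(\mathcal{X})$, and let $f\in\mathcal{L}(\mathcal{X})$, $t\in\mathbb{R}_{\geq0}$ and $\epsilon\in\mathbb{R}_{>0}$. Let $s=(\delta_1,\dots,\delta_k)$ be a sequence in $\mathbb{R}_{\geq0}$ such that $\sum_{i=1}^k\delta_i=t$ and $\delta_i\|\underline{Q}\|\leq2$ for all $i\in\{1,\dots,k\}$. If $\|\underline{T}_tf-\Phi(s)f\|\leq\epsilon/2$ and $\|\Phi(s)f\|_c\leq\epsilon/2$, then for all $\Delta\in\mathbb{R}_{\geq0}$ (with inequalities holding pointwise on $\mathcal{X}$) $$\left|\underline{T}_{t+\Delta}f-\frac{\max\Phi(s)f+\min\Phi(s)f}{2}\right|\leq\epsilon\quad\text{and}\quad\left|\underline{T}_{\infty}f-\frac{\max\Phi(s)f+\min\Phi(s)f}{2}\right|\leq\epsilon.$$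
   Context: $\mathcal{X}$ is a non-empty finite set and $\mathcal{L}(\mathcal{X})$ is the vector space of real-valued functions on $\mathcal{X}$; real numbers are identified with constant functions and inequalities between functions are pointwise. $\|f\|:=\max_{x}|f(x)|$, $\|f\|_v:=\max f-\min f$, $\|f\|_c:=\|f\|_v/2$. $\mathbb{I}_x$ is the indicator function of $\{x\}$, and $I$ is the identity operator. The norm of a non-negatively homogeneous operator $A$ on $\mathcal{L}(\mathcal{X})$ (i.e. $A(\mu f)=\mu Af$ for $\mu\ge0$) is $\|A\|:=\sup\{\|Af\|: \|f\|=1\}$. A lower transition rate operator is a map $\underline{Q}:\mathcal{L}(\mathcal{X})\to\mathcal{L}(\mathcal{X})$ such that for all $f,g\in\mathcal{L}(\mathcal{X})$, $\mu\geq 0$, $\gamma\in\mathbb{R}$ and $x\neq y$ in $\mathcal{X}$: $\underline{Q}\gamma=0$; $\underline{Q}(f+g)\geq\underline{Q}f+\underline{Q}g$; $\underline{Q}(\mu f)=\mu\underline{Q}f$; $[\underline{Q}\mathbb{I}_x](y)\geq 0$. For such $\underline{Q}$ and $f\in\mathcal{L}(\mathcal{X})$, $t\mapsto\underline{T}_tf$ denotes the unique solution on $\mathbb{R}_{\ge0}$ of $\frac{\mathrm d}{\mathrm dt}\underline{T}_tf=\underline{Q}\,\underline{T}_tf$ with $\underline{T}_0f=f$ (existence and uniqueness are known). $\underline{Q}$ is ergodic if for all $f\in\mathcal{L}(\mathcal{X})$, $\underline{T}_\infty f:=\lim_{t\to\infty}\underline{T}_tf$ exists and is a constant function. $\Phi(s):=(I+\delta_k\underline{Q})\cdots(I+\delta_1\underline{Q})$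 for $s=(\delta_1,\dots,\delta_k)$. *)

(* Defs.v *)
From HB Require Import structures.
From mathcomp Require Import all_boot all_order all_algebra.
From mathcomp Require Import all_classical all_reals all_analysis.

Set Implicit Arguments.
Unset Strict Implicit.
Unset Printing Implicit Defensive.

Import Order.TTheory GRing.Theory Num.Theory.
Import numFieldNormedType.Exports.

Local Open Scope classical_set_scope.
Local Open Scope ring_scope.

Section Functions.
Context {R : realType} {X : finType}.
Implicit Types f g : X -> R.

(* When X is non-empty these are attained, see maxf_attained and
   minf_attained. *)
Definition maxf f : R := sup (range f).
Definition minf f : R := inf (range f).

Definition normf f : R := maxf (fun x => `|f x|).
Definition normv f : R := maxf f - minf f.
Definition normc f : R := normv f / 2.

Lemma maxf_attained f : (0 < #|X|)%N ->
  exists2 x, maxf f = f x & forall y, f y <= f x.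
Proof.
move=> /card_gt0P[x0 _].
have [x _ xmax] := @arg_maxP _ R X x0 xpredT f isT.
exists x => [|y]; last exact: xmax.
apply/eqP; rewrite eq_le; apply/andP; split.
  apply: ge_sup; first by exists (f x0), x0.
  by move=> _ [y _ <-]; exact: xmax.
by apply: ub_le_sup; [exists (f x) => _ [y _ <-]; exact: xmax|exists x].
Qed.

Lemma minf_attained f : (0 < #|X|)%N ->
  exists2 x, minf f = f x & forall y, f x <= f y.
Proof.
move=> /card_gt0P[x0 _].
have [x _ xmin] := @arg_minP _ R X x0 xpredT f isT.
exists x => [|y]; last exact: xmin.
apply/eqP; rewrite eq_le; apply/andP; split.
  by apply: ge_inf; [exists (f x) => _ [y _ <-]; exact: xmin|exists x].
apply: lb_le_inf; first by exists (f x0), x0.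
by move=> _ [y _ <-]; exact: xmin.
Qed.

End Functions.

Section Operators.
Context {R : realType} {X : finType}.
Implicit Types (f g : X -> R) (Q A : (X -> R) -> (X -> R)) (u : R -> X -> R).

(* Supremum in R; the set is bounded for lower transition rate operators,
   see opnorm_bounded. *)
Definition opnorm A : R := sup [set normf (A f) | f in [set f | normf f = 1]].

Record lower_rate Q : Prop := LowerRate {
  lower_rate_cst : forall c : R, Q (cst c) = cst 0;
  lower_rate_superadd : forall f g x, Q f x + Q g x <= Q (f + g) x;
  lower_rate_homog : forall (mu : R) f, 0 <= mu -> Q (mu *: f) = mu *: Q f;
  lower_rate_offdiag : forall x y : X, x != y -> 0 <= Q (\1_[set x]) y }.

(* u solves du/dt = Q u on [0, +oo[ with u 0 = f; the derivative is taken in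
   the norm normf, and is one-sided at t = 0. The values of u at negative times
   are irrelevant. *)
Definition solves Q f u : Prop :=
  u 0 = f /\
  forall t, 0 <= t ->
    normf ((s - t)^-1 *: (u s - u t) - Q (u t))
      @[s --> within [set s : R | 0 <= s] t^'] --> (0 : R).

(* The value at time t >= 0 of the solution starting in f. Such a solution
   exists, and is unique on [0, +oo[, for every lower transition rate operator,
   so the default value cst f plays no role there. *)
Definition lowerT Q (t : R) f : X -> R := xget (cst f) [set u | solves Q f u] t.

Definition tends_to u g : Prop := normf (u t - g) @[t --> +oo] --> (0 : R).

Definition ergodic Q : Prop :=
  forall f, exists c : R, tends_to (fun t => lowerT Q t f) (cst c).

Definition lowerTinf Q f : X -> R :=
  xget 0 [set g | tends_to (fun t => lowerT Q t f) g].

(* (I + delta_k Q) o ... o (I + delta_1 Q) for s = [:: delta_1; ...; delta_k]: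
   the head of s is applied first. *)
Definition Phi Q (s : seq R) : (X -> R) -> (X -> R) :=
  foldl (fun A (delta : R) f => A f + delta *: Q (A f)) id s.

End Operators.

Section OperatorNorm.
Context {R : realType} {X : finType}.
Context (Q : (X -> R) -> (X -> R)).
Context (X0 : (0 < #|X|)%N) (Q_rate : lower_rate Q).

Let le_normf (f : X -> R) x : `|f x| <= normf f.
Proof. by rewrite /normf; have [y -> /(_ x)] := maxf_attained (fun x => `|f x|) X0. Qed.

Let normf_le (f : X -> R) c : (forall x, `|f x| <= c) -> normf f <= c.
Proof. by rewrite /normf; have [y -> _] := maxf_attained (fun x => `|f x|) X0. Qed.

Let M : R := \sum_x (normf (Q \1_[set x]) + normf (Q (- \1_[set x]))).

Let Q_sum (r : seq X) (F : X -> X -> R) y :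
  \sum_(x <- r) Q (F x) y <= Q (\sum_(x <- r) F x) y.
Proof.
elim: r => [|x r IH].
  by rewrite !big_nil -[0 : X -> R]/(cst 0) lower_rate_cst.
rewrite !big_cons; apply: le_trans (lower_rate_superadd Q_rate _ _ _).
by rewrite lerD2l.
Qed.

Let indic1 (x z : X) : \1_[set x] z = (z == x)%:R :> R.
Proof. by rewrite indicE; congr (nat_of_bool _)%:R; apply/idP/eqP; rewrite inE. Qed.

Let Q_ge (f : X -> R) y : normf f = 1 -> - M <= Q f y.
Proof.
move=> f1; have fE : f = \sum_x (f x *: \1_[set x] : X -> R).
  apply/funext => z; rewrite fct_sumE (bigD1 z) //= big1 => [|x xz].
    by rewrite /GRing.scale /= indic1 eqxx [_ *: _]mulr1 addr0.
  by rewrite /GRing.scale /= indic1 eq_sym (negbTE xz) [_ *: _]mulr0.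
rewrite {1}fE; apply: le_trans (Q_sum _ _ _).
rewrite -sumrN ler_sum // => x _.
have fx1 : `|f x| <= 1 by rewrite -f1 le_normf.
have n0 (g : X -> R) : 0 <= normf g by apply: le_trans (le_normf g y).
have bound (a : R) g : 0 <= a <= 1 -> - normf (Q g) <= Q (a *: g) y.
  move=> /andP[a0 a1]; rewrite lower_rate_homog // lerNl.
  apply: le_trans (le_trans (ler_norm _) _) => //.
  rewrite normrN [X in `|X|]/GRing.scale /= normrM (ger0_norm a0).
  by rewrite -[leRHS]mul1r ler_pM.
have [fx0|/ltW fx0] := lerP 0 (f x).
  apply: (@le_trans _ _ (- normf (Q \1_[set x]))).
    by rewrite lerN2 lerDl.
  by apply: bound; rewrite fx0 -(ger0_norm fx0).
apply: (@le_trans _ _ (- normf (Q (- \1_[set x])))).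
  by rewrite lerN2 lerDr.
rewrite -[f x *: _]opprK -scalerN -scaleNr.
by apply: bound; rewrite oppr_ge0 fx0 -(ler0_norm fx0).
Qed.

Lemma opnorm_bounded :
  has_ubound [set normf (Q f) | f in [set f | normf f = 1]].
Proof.
exists M => _ [f /= f1 <-]; apply: normf_le => y.
rewrite ler_norml Q_ge //=.
have := lower_rate_superadd Q_rate f (- f) y.
rewrite subrr -[0 : X -> R]/(cst 0) lower_rate_cst //= -lerBrDr sub0r => /le_trans; apply.
rewrite lerNl; apply: Q_ge; rewrite -f1 /normf; congr maxf.
by apply/funext => x; rewrite -normrN opprK.
Qed.

End OperatorNorm.

(* Main.v *)
(** The derivative of a solution [u] of [du/dt = Q u] is nonpositive at a state
    where [u t] is maximal and nonnegative where it is minimal, so the range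
    [[min u t, max u t]] shrinks as [t] grows. Hence once [u t] lies within
    [eps / 2] of [Phi Q s f], whose range is at most [eps] wide, every later
    value and the limit stay within [eps] of the midpoint of that range.

    No general existence theorem for solutions is needed: if no solution starts
    in [f] then [lowerT Q t f] is constantly [f], so ergodicity forces [f] to be
    constant, and a constant function is a stationary solution. *)
Require Import Defs.
From mathcomp Require Import all_boot all_order all_algebra.
From mathcomp Require Import all_classical all_reals all_analysis.
From mathcomp Require Import ring lra.

Set Implicit Arguments.
Unset Strict Implicit.
Unset Printing Implicit Defensive.

Import Order.TTheory GRing.Theory Num.Theory.
Import numFieldNormedType.Exports.
Local Open Scope classical_set_scope.
Local Open Scope ring_scope.

(** * Bounds by the maximum, the minimum and the norm *)

Section FunctionNorm.
Context {R : realType} {X : finType}.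
Hypothesis X_gt0 : (0 < #|X|)%N.
Implicit Types f : X -> R.

Lemma le_maxf f x : f x <= maxf f.
Proof. by have [y -> /(_ x)] := maxf_attained f X_gt0. Qed.

Lemma maxf_le f c : (forall x, f x <= c) -> maxf f <= c.
Proof. by have [y -> _] := maxf_attained f X_gt0. Qed.

Lemma minf_le f x : minf f <= f x.
Proof. by have [y -> /(_ x)] := minf_attained f X_gt0. Qed.

Lemma le_normf f x : `|f x| <= normf f.
Proof. exact: (le_maxf (fun x => `|f x|)). Qed.

Lemma normf_ge0 f : 0 <= normf f.
Proof. by have /card_gt0P[x _] := X_gt0; apply: le_trans (le_normf f x). Qed.

Lemma normf0 : normf (0 : X -> R) = 0.
Proof.
by apply/eqP; rewrite eq_le normf_ge0 andbT; apply: maxf_le => x; rewrite normr0.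
Qed.

End FunctionNorm.

(** * Sign of a rate operator at extremal states *)

Section MaximumPrinciple.
Context {R : realType} {X : finType} {Q : (X -> R) -> (X -> R)}.
Hypothesis Q_rate : lower_rate Q.
Implicit Types g h : X -> R.

Lemma lower_rate0 : Q 0 = 0.
Proof. exact: (lower_rate_cst Q_rate 0). Qed.

Lemma lower_rate_superadd_sum (r : seq X) (F : X -> X -> R) y :
  \sum_(x <- r) Q (F x) y <= Q (\sum_(x <- r) F x) y.
Proof.
elim: r => [|x r IH]; first by rewrite !big_nil lower_rate0.
by rewrite !big_cons (le_trans _ (lower_rate_superadd Q_rate _ _ _)) ?lerD2l.
Qed.

Lemma sum_indic_fct h : h = \sum_x (h x *: \1_[set x] : X -> R).
Proof.
apply/funext => z; rewrite fct_sumE (bigD1 z) //= big1 => [|x xz].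
  by rewrite addr0 /GRing.scale /= indicE mem_set// [_ *: _]mulr1.
rewrite /GRing.scale /= indicE memNset ?[_ *: _]mulr0// => zx.
by rewrite /= in zx; rewrite zx eqxx in xz.
Qed.

(** Expanding [h] in indicators and using superadditivity bounds [Q h y] below by a sum of
    off-diagonal rates with nonnegative weights; the diagonal term has weight [h y = 0]. *)
Lemma lower_rate_ge0 h y : (forall x, 0 <= h x) -> h y = 0 -> 0 <= Q h y.
Proof.
move=> h0 hy; rewrite [h]sum_indic_fct.
apply: le_trans (lower_rate_superadd_sum _ _ _); apply: sumr_ge0 => x _.
have [->|xy] := eqVneq x y; first by rewrite hy scale0r lower_rate0.
rewrite lower_rate_homog//; apply: mulr_ge0 => //.
exact: lower_rate_offdiag.
Qed.

Lemma lower_rate_at_min g x : (forall y, g x <= g y) -> 0 <= Q g x.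
Proof.
move=> gx; have -> : g = (fun y => g y - g x) + cst (g x).
  by apply/funext => y; rewrite /GRing.add /= subrK.
apply: le_trans (lower_rate_superadd Q_rate _ _ _).
rewrite lower_rate_cst// addr0; apply: lower_rate_ge0 => [y|].
  by rewrite subr_ge0.
by rewrite subrr.
Qed.

(** Superadditivity gives [Q g + Q (- g) <= Q 0 = 0], and [- g] is minimal at [x]. *)
Lemma lower_rate_at_max g x : (forall y, g y <= g x) -> Q g x <= 0.
Proof.
move=> gx; have := lower_rate_superadd Q_rate g (- g) x.
rewrite subrr lower_rate0; apply: le_trans; rewrite lerDl.
by apply: lower_rate_at_min => y; rewrite lerN2.
Qed.

End MaximumPrinciple.

(** * Monotonicity in time of the maximum and the minimum *)

Section MaxNonincreasing.
Context {R : realType} {X : finType}.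
Hypothesis X_gt0 : (0 < #|X|)%N.

(* [D] is the derivative of [w] on [0, +oo[, one-sided at 0. *)
Definition first_order (w D : R -> X -> R) : Prop :=
  forall (t e : R) x, 0 <= t -> 0 < e -> \forall s \near t, 0 <= s ->
    `|w s x - w t x - (s - t) * D t x| <= e * `|s - t|.

Lemma first_orderN w D : first_order w D -> first_order (- w) (- D).
Proof.
move=> wD t e x t0 e0; apply: filterS (wD t e x t0 e0) => s + s0.
move=> /(_ s0); rewrite -normrN; apply: le_trans.
rewrite -[X in `|X| <= _]/(- w s x - - w t x - (s - t) * - D t x).
by rewrite le_eqVlt; apply/orP; left; apply/eqP; congr `|_|; ring.
Qed.

Lemma first_order_continuous w D x (a b : R) : first_order w D -> 0 <= a ->
  {within `[a, b], continuous (fun s => w s x)}.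
Proof.
move=> wD a0; apply/subspace_continuousP => t /=; rewrite in_itv/= => /andP[at_ _].
have t0 : 0 <= t by exact: le_trans at_.
(* With error rate 1 the first-order expansion makes the increment at most [K * |s - t|]. *)
apply/cvgrPdist_le => e e0.
pose K : R := 1 + `|D t x|.
have K0 : 0 < K by rewrite /K ltr_wpDr.
have near_t : \forall s \near t, `|t - s| < e / K.
  exact: nbhsx_ballx (divr_gt0 e0 K0).
rewrite near_withinE; near=> s; rewrite /= in_itv/= => /andP[as_ _].
have s0 : 0 <= s by exact: le_trans as_.
have /(_ s0) : 0 <= s -> `|w s x - w t x - (s - t) * D t x| <= 1 * `|s - t|.
  by near: s; exact: wD.
rewrite mul1r => st.
have : `|t - s| < e / K by near: s.
rewrite ltr_pdivlMr// [`|t - s|]distrC => /ltW; apply: le_trans.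
suff : `|w t x - w s x| <= `|s - t| * K by [].
rewrite (distrC (w t x)).
rewrite -[w s x - w t x](subrK ((s - t) * D t x)) (le_trans (ler_normD _ _))//.
by rewrite normrM mulrDr mulr1 lerD2r.
Unshelve. all: by end_near. Qed.

(* Maximise [w s x - k (s - a)], with [k > 0] small, over both [x] and [s] in
   [[a, b]]: at a maximiser with [a < s] the state is maximal for [w s], so the
   slope there is at most [- k], which contradicts maximality from the left. *)
Lemma max_nonincreasing w D (a b : R) x : first_order w D ->
  (forall s y, 0 <= s -> (forall z, w s z <= w s y) -> D s y <= 0) ->
  0 <= a -> a <= b -> w b x <= maxf (w a).
Proof.
move=> wD D_max a0 ab; apply/ler_addgt0Pr => e e0.
(* This gives [k * (b - a) <= e]; the added 1 keeps the denominator positive when [a = b]. *)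
pose k := e / (b - a + 1).
have ba : 0 < b - a + 1 by lra.
have k0 : 0 < k by exact: divr_gt0.
pose v y s := w s y - k * (s - a).
have v_max y : exists c,
    c \in `[a, b] /\ forall s, s \in `[a, b] -> v y s <= v y c.
  have /subspace_continuousP wc := @first_order_continuous w D y a b wD a0.
  suff [c cab cmax] : exists2 c, c \in `[a, b] &
      forall s, s \in `[a, b] -> v y s <= v y c by exists c.
  apply: EVT_max => //; apply/subspace_continuousP => s sab; apply: cvgB.
    exact: wc.
  apply: cvg_within_filter; apply: cvgMr; apply: cvgB; last exact: cvg_cst.
  exact: cvg_id.
(* First a best time [c y] for each state, then a best state: [(y, r)] is a joint maximiser. *)
have [c cP] := choice v_max.
have [y _ ymax] := @arg_maxP _ R X x xpredT (fun y => v y (c y)) isT.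
set r := c y.
have vmax z s : s \in `[a, b] -> v z s <= v y r.
  by move=> sab; apply: le_trans ((cP z).2 _ sab) (ymax z isT).
suff ra : r = a.
  have := vmax x b; rewrite in_itv/= ab lexx => /(_ isT).
  rewrite ra /v subrr mulr0 subr0 lerBlDr => /le_trans; apply.
  apply: lerD; first exact: le_maxf.
  by rewrite /k mulrAC ler_pdivrMr// ler_pM2l//; lra.
have r0 : 0 <= r.
  by have [+ _] := cP y; rewrite in_itv/= => /andP[/(le_trans a0)].
have [ar rb] : a <= r /\ r <= b by apply/andP; have [+ _] := cP y; rewrite in_itv.
apply/eqP; rewrite eq_le ar andbT leNgt; apply/negP => lt_ar.
have Dr : D r y <= 0.
  apply: D_max => // z; have := vmax z r; rewrite in_itv/= ar rb => /(_ isT).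
  by rewrite /v lerD2r.
near r^'- => s.
have sr : s < r by near: s; exact: nbhs_left_lt.
have as_ : a < s by near: s; exact: nbhs_left_gt.
have s0 : 0 <= s by exact: le_trans (ltW as_).
(* Maximality at [r] makes [w s y - w r y] at most [- k * (r - s)], whereas [D r y <= 0] and error
   rate [k / 2] make it at least [- k / 2 * (r - s)]. *)
have /(_ s0) : 0 <= s -> `|w s y - w r y - (s - r) * D r y| <= k / 2 * `|s - r|.
  by near: s; apply: cvg_within; apply: wD => //; exact: divr_gt0.
have := vmax y s; rewrite in_itv/= (ltW as_) (le_trans (ltW sr) rb) => /(_ isT).
rewrite /v (ltr0_norm (x := s - r)) ?subr_lt0// ler_norml => vs /andP[lb _].
have : (s - r) * D r y >= 0 by apply: mulr_le0 => //; lra.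
have : 0 < k * (r - s) by apply: mulr_gt0 => //; lra.
nra.
Unshelve. all: by end_near. Qed.

Lemma min_nondecreasing w D (a b : R) x : first_order w D ->
  (forall s y, 0 <= s -> (forall z, w s y <= w s z) -> 0 <= D s y) ->
  0 <= a -> a <= b -> minf (w a) <= w b x.
Proof.
move=> wD D_min a0 ab; rewrite -lerN2.
apply: (le_trans (max_nonincreasing x (first_orderN wD) _ a0 ab)).
  move=> s y s0 ws; rewrite oppr_le0; apply: D_min => // z.
  by rewrite -lerN2; exact: ws.
by apply: maxf_le => // y; rewrite lerN2; exact: minf_le.
Qed.

End MaxNonincreasing.

(** * Solutions of the differential equation and their limit *)

Section LowerTransition.
Context {R : realType} {X : finType} {Q : (X -> R) -> (X -> R)}.
Hypotheses (X_gt0 : (0 < #|X|)%N) (Q_rate : lower_rate Q).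
Implicit Types f g : X -> R.

(** Multiplying the difference quotient by [s - t] removes the division, so the punctured
    neighbourhood can be filled in: at [s = t] both sides vanish. *)
Lemma solves_first_order f u : solves Q f u -> first_order u (fun t => Q (u t)).
Proof.
move=> [_ u'] t e x t0 e0; have /cvgr0Pnorm_le /(_ e e0) := u' t t0.
rewrite near_withinE => near_t.
have {}near_t := near_t : \forall s \near t^', 0 <= s ->
  `|normf ((s - t)^-1 *: (u s - u t) - Q (u t))| <= e.
move: near_t; rewrite near_withinE; apply: filterS => s + s0.
have [->|st] := eqVneq s t; first by rewrite !subrr mul0r subrr !normr0 mulr0.
move=> /(_ isT s0); rewrite ger0_norm ?normf_ge0// => /(le_trans (le_normf X_gt0 _ x)).
have st0 : s - t != 0 by rewrite subr_eq0.
rewrite -(ler_pM2r (x := `|s - t|)) ?normr_gt0// -normrM; apply: le_trans.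
suff -> : u s x - u t x - (s - t) * Q (u t) x =
  ((s - t)^-1 * (u s x - u t x) - Q (u t) x) * (s - t) by [].
by field.
Qed.

Lemma solves_cst (c : R) : solves Q (cst c) (fun=> cst c).
Proof.
split=> // t t0; rewrite (lower_rate_cst Q_rate).
apply: cvg_near_cst; apply: nearW => s.
by rewrite subrr scaler0 sub0r -[cst 0 : X -> R]/(0 : X -> R) oppr0 normf0.
Qed.

Lemma ergodic_solves f : ergodic Q -> solves Q f (fun t => lowerT Q t f).
Proof.
move=> Q_erg; have [c fc] := Q_erg f.
rewrite /lowerT; case: xgetP => [u _ //|no_sol]; exfalso.
have lowerTE t : lowerT Q t f = f by rewrite /lowerT; case: xgetP => // u _ /no_sol.
have f_cst : f = cst c.
  apply/funext => x; apply/eqP; rewrite -subr_eq0 -normr_le0.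
  (* The distance from [f] to [cst c] does not depend on time, so it equals its limit 0. *)
  have /cvg_lim <- // := fc.
  under eq_fun do rewrite lowerTE.
  by rewrite lim_cst//; exact: (le_normf X_gt0 (f - cst c)).
by apply: (no_sol (fun=> f)); rewrite /= f_cst; exact: solves_cst.
Qed.

Lemma lowerT_le_max f (t s : R) x : ergodic Q -> 0 <= t -> t <= s ->
  lowerT Q s f x <= maxf (lowerT Q t f).
Proof.
move=> /(ergodic_solves f)/solves_first_order/max_nonincreasing; apply => //.
by move=> r y _; exact: lower_rate_at_max.
Qed.

Lemma lowerT_ge_min f (t s : R) x : ergodic Q -> 0 <= t -> t <= s ->
  minf (lowerT Q t f) <= lowerT Q s f x.
Proof.
move=> /(ergodic_solves f)/solves_first_order/min_nondecreasing; apply => //.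
by move=> r y _; exact: lower_rate_at_min.
Qed.

Lemma lowerTinf_cvg f x : ergodic Q ->
  lowerT Q t f x @[t --> +oo] --> lowerTinf Q f x.
Proof.
move=> Q_erg; have : tends_to (fun t => lowerT Q t f) (lowerTinf Q f).
  (* Ergodicity supplies a limit, which excludes the default value of [xget]. *)
  rewrite /lowerTinf; case: xgetP => [g _ //|no_lim].
  by have [c /no_lim] := Q_erg f.
move=> /cvgr0Pnorm_le fT; apply/cvgrPdist_le => e /fT; apply: filterS => t.
rewrite distrC ger0_norm ?normf_ge0//; apply: le_trans.
exact: (le_normf X_gt0 (lowerT Q t f - lowerTinf Q f)).
Qed.

End LowerTransition.

Theorem proposition12 (R : realType) (X : finType) (X_gt0 : (0 < #|X|)%N)
    (Q : (X -> R) -> (X -> R)) (Q_rate : lower_rate Q) (Q_erg : ergodic Q)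
    (f : X -> R) (t eps : R) (t_ge0 : 0 <= t) (eps_gt0 : 0 < eps)
    (s : seq R) (s_ge0 : forall delta : R, delta \in s -> 0 <= delta)
    (s_sum : \sum_(delta <- s) delta = t)
    (s_norm : forall delta : R, delta \in s -> delta * opnorm Q <= 2)
    (err_le : normf (lowerT Q t f - Phi Q s f) <= eps / 2)
    (normc_le : normc (Phi Q s f) <= eps / 2) :
  forall Delta : R, 0 <= Delta ->
    (forall x : X,
       `|lowerT Q (t + Delta) f x
         - (maxf (Phi Q s f) + minf (Phi Q s f)) / 2| <= eps)
    /\
    (forall x : X,
       `|lowerTinf Q f x
         - (maxf (Phi Q s f) + minf (Phi Q s f)) / 2| <= eps).
Proof.
set g := Phi Q s f in err_le normc_le *; set m := (_ + _) / 2.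
have near_m (r : R) x : t <= r -> `|lowerT Q r f x - m| <= eps.
  move=> tr; have := lowerT_le_max X_gt0 Q_rate f x Q_erg t_ge0 tr.
  have := lowerT_ge_min X_gt0 Q_rate f x Q_erg t_ge0 tr.
  have [y -> _] := maxf_attained (lowerT Q t f) X_gt0.
  have [z -> _] := minf_attained (lowerT Q t f) X_gt0.
  have err y' : `|lowerT Q t f y' - g y'| <= eps / 2.
    by apply: le_trans err_le; exact: (le_normf X_gt0 (lowerT Q t f - g)).
  (* The extremes of [lowerT Q t f] exceed those of [g] by at most [eps / 2], and the extremes of
     [g] lie at distance [normc g <= eps / 2] from [m]. *)
  move: (err y) (err z) (le_maxf X_gt0 g y) (minf_le X_gt0 g z) normc_le.
  by rewrite /m /normc /normv !ler_norml => /andP[? ?] /andP[? ?] ? ? ? ? ?; lra.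
move=> Delta Delta0; split=> x; first by apply: near_m; rewrite lerDl.
(* The bound is closed and holds for all times from [t] on, so it passes to the limit. *)
have dist_cvg : `|lowerT Q r f x - m| @[r --> +oo] --> `|lowerTinf Q f x - m|.
  by apply: cvg_norm; apply: cvgB; [exact: lowerTinf_cvg|exact: cvg_cst].
apply: (cvgr_to_le dist_cvg).
near=> r; apply: near_m; near: r; apply: nbhs_pinfty_ge; exact: num_real.
Unshelve. all: by end_near. Qed.
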